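(* Let $1\le k\le n$ be integers, let $p\in(0,1)$, and let $X_1,\ldots,X_n$ be $k$-wise independent random variables such that $0\le X_i\le1$ and $\mathbb{E}[X_i]=p$ for each $i=1,\ldots,n$. Fix $\varepsilon>0$ with $p(1+\varepsilon)<1$. Then $$\mathbb{P}\left[\sum_{i=1}^nX_i\ge np(1+\varepsilon)\right]\le\frac{1}{(p-p^2)^{n-k}}\,e^{-nD(p(1+\varepsilon)\|p)}.$$
   Context: Random variables $X_1,\ldots,X_n$ are $k$-wise independent if for any subset of $k$ indices $\{i_1,\ldots,i_k\}\subseteq\{1,\ldots,n\}$ and all outcomes $x_{i_1},\ldots,x_{i_k}$ one has $\mathbb{P}[X_{i_1}\le x_{i_1}\cap\cdots\cap X_{i_k}\le x_{i_k}]=\prod_{j=1}^k\mathbb{P}[X_{i_j}\le x_{i_j}]$. For $q,p\in(0,1)$, $D(q\|p)=q\ln\frac qp+(1-q)\ln\frac{1-q}{1-p}$ is the Kullback-Leibler distance. *)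

(* Defs.v *)
From mathcomp Require Import all_boot all_order all_algebra.
From mathcomp Require Import all_classical all_reals all_analysis.

Set Implicit Arguments.
Unset Strict Implicit.
Unset Printing Implicit Defensive.

Import Order.TTheory GRing.Theory Num.Theory.

Local Open Scope classical_set_scope.
Local Open Scope ring_scope.

(* Independence is tested on the joint distribution functions of exactly [k]
   distinct variables; smaller families follow by letting thresholds tend
   to infinity. *)
Definition kwise_independent (d : measure_display) (T : measurableType d)
    (R : realType) (P : probability T R) (n k : nat)
    (X : 'I_n -> {RV P >-> R}) : Prop :=
  forall (A : {set 'I_n}) (x : 'I_n -> R), #|A| = k ->
    (P [set t | forall i, i \in A -> (X i t <= x i)%R]
     = \prod_(i in A) P [set t | (X i t <= x i)%R])%E.

(* Kullback-Leibler distance between the Bernoulli laws of parameters [q] and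
   [p]; meaningful for [q], [p] in the open unit interval. *)
Definition kl_dist (R : realType) (q p : R) : R :=
  q * ln (q / p) + (1 - q) * ln ((1 - q) / (1 - p)).

(* Main.v *)
Require Import Defs.
From mathcomp Require Import all_boot all_order all_algebra.
From mathcomp Require Import all_classical all_reals all_analysis.
From mathcomp Require Import measurable_realfun ring lra.

Import Order.TTheory GRing.Theory Num.Theory.

Local Open Scope classical_set_scope.
Local Open Scope ring_scope.

(** The proof is a Chernoff bound in which [n - k] of the variables are treated
    crudely.  Put [t = p (1 + eps)] and let [h >= 0].  Fix a set [A] of [k]
    indices.  On the event [sum_i X_i >= n t],
      [1 <= exp (- h n t) exp (h sum_i X_i)
         <= exp (- h n t) exp (h (n - k)) prod_(i in A) exp (h X_i)],
    because almost surely each variable outside [A] is at most [1].  By convexity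
    [exp (h x) <= 1 + (exp h - 1) x] on the unit interval, and the variables
    indexed by [A] are independent, so taking expectations gives
      [P (sum_i X_i >= n t)
         <= exp (h (n - k) - h n t) (1 + (exp h - 1) p) ^ k],
    which is [kwise_chernoff].  Choose the classical tilt
    [exp h = (t / p) ((1 - p) / (1 - t))]; then
    [1 + (exp h - 1) p = (1 - p) / (1 - t)], and [kl_dist_tilt] rewrites the
    bound as [(t / p) ^ (n - k) exp (- n D (t || p))].  It remains to observe
    that [t / p < 1 / p <= 1 / (p - p ^ 2)].

    The point that needs care is the product rule for the expectation of
    [prod_(i in A) (1 + c X_i)] with [c = exp h - 1 >= 0], since independence
    is given through joint distribution functions only.  Only the upper bound
    [(1 + c p) ^ k] matters ([kwise_prod_affine_le]), and it can be had without
    product measures: the function [1 + c x] is dominated on the unit interval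
    by a staircase, exceeding it by at most [c / m], which is a linear
    combination of indicators of half-lines [x <= a].  For such functions the
    product rule is the hypothesis itself, expanded by distributivity
    ([integral_prod_step]).  Then [m] tends to infinity. *)

(** * Two elementary inequalities *)

(** The sum is the ceiling of [y]. *)
Lemma count_lt_bounds (R : realType) (y : R) (m : nat) :
  0 <= y -> y <= m%:R -> y <= \sum_(j < m) (j%:R < y)%R%:R <= y + 1.
Proof.
move=> y0 ym.
pose S (k : nat) : R := \sum_(j < k) (j%:R < y)%R%:R.
suff : [/\ S m <= m%:R, S m <= y + 1 & m%:R <= S m \/ y <= S m].
  by case=> _ up [|low]; rewrite -/(S m) up andbT//; exact: le_trans.
rewrite /S.
elim: m {ym} => [|m [IH1 IH2 IH3]].
  by rewrite big_ord0; split; [|rewrite addr_ge0|left].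
rewrite big_ord_recr /= -natr1.
by case: ltP => my /=; split; try lra; case: IH3 => ?; try (left; lra);
  right; lra.
Qed.

(** The convex function [expR (h * x)] lies below its chord over the unit
    interval. *)
Lemma expR_chord (R : realType) (h x : R) :
  0 <= x <= 1 -> expR (h * x) <= 1 + (expR h - 1) * x.
Proof.
move=> x01; have [x0 x1] := andP x01.
have := @convex_expR R (Itv01 x0 x1) h 0.
rewrite !convRE/= expR0 mulr0 addr0 mulr1 [x * h]mulrC.
by move=> /le_trans -> //; rewrite /unstable.onem; lra.
Qed.

(** * Staircases above an affine function *)

Definition step {R : realType} {s : nat} (a x : 'I_s -> R) (y : R) : R :=
  \sum_(j < s) a j * (y <= x j)%R%:R.

(** An upper approximation of [1 + c y] on the unit interval.  The constant term
    is carried by the indicator of [y <= 1], so that all terms are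
    indicators of half-lines, which is the form in which independence is
    available. *)
Definition stair {R : realType} (c : R) (m : nat) : R -> R :=
  step (fun j : 'I_m.+2 => if j == ord_max then 1 + c else - (c / m.+1%:R))
       (fun j : 'I_m.+2 => j%:R / m.+1%:R).

Lemma stairE (R : realType) (c : R) (m : nat) (y : R) :
  stair c m y = (1 + c) * (y <= 1)%R%:R
    - c / m.+1%:R * \sum_(j < m.+1) (y <= j%:R / m.+1%:R)%R%:R.
Proof.
rewrite /stair /step big_ord_recr/= eqxx divff ?pnatr_eq0// [LHS]addrC; congr (_ + _).
rewrite mulr_sumr -sumrN; apply: eq_bigr => j _.
by rewrite -val_eqE/= ltn_eqF// !mulNr.
Qed.

Lemma stair_bounds (R : realType) (c : R) (m : nat) (y : R) :
  0 <= c -> 0 <= y <= 1 ->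
  1 + c * y <= stair c m y <= 1 + c * y + c / m.+1%:R.
Proof.
move=> c0 /andP[y0 y1]; rewrite stairE y1 mulr1.
have m0 : 0 < m.+1%:R :> R by rewrite ltr0n.
have := @count_lt_bounds R (y * m.+1%:R) m.+1.
rewrite mulr_ge0// => /(_ isT); rewrite ler_piMl// => /(_ isT) /andP[lo up].
have -> : \sum_(j < m.+1) (y <= j%:R / m.+1%:R)%R%:R
    = m.+1%:R - \sum_(j < m.+1) (j%:R < y * m.+1%:R)%R%:R :> R.
  apply/eqP; rewrite -subr_eq0 opprB addrA -big_split/= subr_eq0; apply/eqP.
  rewrite (eq_bigr (fun=> 1)) ?sumr_const ?card_ord// => j _.
  by rewrite ler_pdivlMr// ltNge; case: leP => _; rewrite (addr0, add0r).
set N := \sum_(j < m.+1) _ in lo up *.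
have -> : 1 + c - c / m.+1%:R * (m.+1%:R - N) = 1 + c * (N / m.+1%:R).
  by field; rewrite ?nat1r ?natr1 pnatr_eq0.
have -> : 1 + c * y + c / m.+1%:R = 1 + c * ((y * m.+1%:R + 1) / m.+1%:R).
  by field; rewrite ?nat1r ?natr1 pnatr_eq0.
by rewrite !lerD2l !ler_wpM2l// ?ler_pM2r ?invr_gt0 ?ler_pdivlMr.
Qed.

Lemma stair_ge0 (R : realType) (c : R) (m : nat) (y : R) :
  0 <= c -> 0 <= stair c m y.
Proof.
move=> c0; have m0 : 0 < m.+1%:R :> R by rewrite ltr0n.
have [y1|y1] := leP y 1; rewrite stairE.
  rewrite y1 mulr1 subr_ge0 (@le_trans _ _ c)//; last by rewrite lerDr.
  rewrite mulrAC ler_pdivrMr// ler_wpM2l//.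
  rewrite -[X in _ <= X](_ : \sum_(j < m.+1) 1 = _); last first.
    by rewrite sumr_const card_ord.
  by apply: ler_sum => j _; rewrite lern1 leq_b1.
rewrite (leNgt y) y1/= mulr0 sub0r big1 ?mulr0 ?oppr0// => j _.
rewrite (leNgt y) (le_lt_trans _ y1)// ler_pdivrMr// mul1r ler_nat.
exact: ltnW.
Qed.

(** * The product rule for step functions *)

Section kwise.
Import numFieldNormedType.Exports.
Context (d : measure_display) (T : measurableType d) (R : realType)
  (P : probability T R).

Lemma integral_lincomb_indic (I : Type) (s : seq I) (Q : pred I)
    (a : I -> R) (E : I -> set T) :
  (forall i, measurable (E i)) ->
  (\int[P]_t (\sum_(i <- s | Q i) a i * \1_(E i) t)%:E
   = (\sum_(i <- s | Q i) a i * fine (P (E i)))%:E)%E.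
Proof.
move=> mE.
under eq_integral do rewrite -sumEFin.
rewrite integral_sum//; last first.
  move=> i; rewrite (_ : (fun _ => _) = (fun t => (a i)%:E * (\1_(E i) t)%:E)%E).
    by apply: integrableZl => //; exact: integrable_indic.
  by apply/funext => t; rewrite EFinM.
rewrite -sumEFin; apply: eq_bigr => i _.
under eq_integral do rewrite EFinM.
rewrite integralZl//; last exact: integrable_indic.
by rewrite integral_indic// setIT EFinM fineK// fin_num_measure.
Qed.

Lemma measurable_le_RV (X : {RV P >-> R}) (x : R) :
  measurable [set t | X t <= x].
Proof.
rewrite (_ : [set t | _] = setT `&` X @^-1` `]-oo, x]).
  exact: measurable_funPT.
by apply/seteqP; split => t /=; rewrite in_itv/=; [split|case].
Qed.

Lemma integral_step (X : {RV P >-> R}) (s : nat) (a x : 'I_s -> R) :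
  (\int[P]_t (step a x (X t))%:E
   = (\sum_(j < s) a j * fine (P [set t | (X t <= x j)%R]))%:E)%E.
Proof.
rewrite -integral_lincomb_indic; last by move=> j; exact: measurable_le_RV.
apply: eq_integral => t _; congr EFin; apply: eq_bigr => j _.
by rewrite indicE mem_setE.
Qed.

(** Expanding the product of the sums gives one term for each choice [f] of a
    threshold for every index of [A]; its integral is the probability of a
    joint event on exactly [k] variables, which factorizes by hypothesis.
    Folding the expansion back gives the product of the integrals. *)
Lemma integral_prod_step (n k : nat) (X : 'I_n -> {RV P >-> R})
    (A : {set 'I_n}) (s : nat) (a x : 'I_s.+1 -> R) :
  kwise_independent k X -> #|A| = k ->
  (\int[P]_t (\prod_(i in A) step a x (X i t))%:E
   = (\prod_(i in A) fine (\int[P]_t (step a x (X i t))%:E))%:E)%E.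
Proof.
move=> indep cardA.
under [in RHS]eq_bigr do rewrite integral_step /=.
(* [ord0] is the dummy threshold attached to the indices outside [A] *)
under eq_integral do rewrite /step (big_distr_big ord0).
rewrite (big_distr_big ord0).
pose E (f : {ffun 'I_n -> 'I_s.+1}) :=
  [set t | forall i, i \in A -> X i t <= x (f i)].
have mE f : measurable (E f).
  rewrite (_ : E f = \bigcap_(i in [set i | i \in A]) [set t | X i t <= x (f i)]).
    by apply: fin_bigcap_measurable => // i _; exact: measurable_le_RV.
  by apply/seteqP; split.
transitivity (\int[P]_t (\sum_(f in pffun_on ord0 (mem A) predT)
    (\prod_(i in A) a (f i)) * \1_(E f) t)%:E)%E.
  apply: eq_integral => t _; congr EFin; apply: eq_bigr => f _.
  rewrite big_split/=; congr (_ * _).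
  have [Et|nEt] := pselect (E f t).
    by rewrite indicE mem_set// big1// => i /Et ->.
  rewrite indicE memNset//; apply/eqP/prodf_eq0.
  have [i [iA /negP/negbTE h]] : exists i, i \in A /\ ~ (X i t <= x (f i)).
    by apply: contrapT => /forallNP h; apply: nEt => i iA;
      apply: contrapT => h'; apply: (h i).
  by exists i; rewrite // h.
rewrite integral_lincomb_indic//; congr EFin; apply: eq_bigr => f _.
rewrite big_split/=; congr (_ * _).
have := indep A (fun i => x (f i)) cardA; rewrite -/(E f) => ->.
rewrite (eq_bigr (fun i => (fine (P [set t | X i t <= x (f i)]))%:E)).
  by rewrite prodEFin.
by move=> i _; rewrite fineK// fin_num_measure//; exact: measurable_le_RV.
Qed.

(** * The Chernoff bound under [k]-wise independence *)

Lemma measurable_stair (X : {RV P >-> R}) (c : R) (m : nat) :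
  measurable_fun setT (fun t => stair c m (X t)).
Proof.
rewrite /stair /step.
apply: measurable_sum => j; apply: measurable_funM => //.
rewrite (_ : (fun _ => _) = \1_[set t | X t <= j%:R / m.+1%:R]).
  exact/measurable_indic/measurable_le_RV.
by apply/funext => t; rewrite indicE mem_setE.
Qed.

(** Absolute values make the integrands nonnegative everywhere, as comparison of
    integrals almost everywhere requires, at no cost in the mean. *)
Lemma integral_normr_ae01 (X : {RV P >-> R}) :
  {ae P, forall t, 0 <= X t <= 1} ->
  (\int[P]_t `|X t|%:E = 'E_P[X])%E.
Proof.
move=> X01; rewrite expectation_def; apply: ae_eq_integral => //.
- by apply/measurable_EFinP; exact: measurableT_comp.
- exact/measurable_EFinP.
- by apply: filterS X01 => t /andP[X0 _] _; rewrite ger0_norm.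
Qed.

Lemma integral_stair_le (X : {RV P >-> R}) (c p : R) (m : nat) :
  0 <= c -> {ae P, forall t, 0 <= X t <= 1} -> ('E_P[X] = p%:E)%E ->
  (\int[P]_t (stair c m (X t))%:E <= (1 + c * p + c / m.+1%:R)%:E)%E.
Proof.
move=> c0 X01 EX.
have d0 : 0 <= 1 + c / m.+1%:R by rewrite addr_ge0// divr_ge0.
have mX : measurable_fun setT (fun t => `|X t|) by exact: measurableT_comp.
apply: (@le_trans _ _ (\int[P]_t ((1 + c / m.+1%:R)%:E + c%:E * `|X t|%:E))%E).
  apply: ae_ge0_le_integral => //.
  - by move=> t _; rewrite lee_fin stair_ge0.
  - exact/measurable_EFinP/measurable_stair.
  - by move=> t _; rewrite -EFinM -EFinD lee_fin addr_ge0// mulr_ge0.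
  - apply: emeasurable_funD => //; apply: emeasurable_funM => //.
    exact/measurable_EFinP.
  - apply: filterS X01 => t X01 _; rewrite -EFinM -EFinD lee_fin.
    have /andP[X0 _] := X01.
    have /andP[_ /le_trans->//] := @stair_bounds R c m _ c0 X01.
    by rewrite ger0_norm// addrAC.
rewrite ge0_integralD//; last 2 first.
- by move=> t _; rewrite -EFinM lee_fin mulr_ge0.
- by apply: emeasurable_funM => //; exact/measurable_EFinP.
have -> : (\int[P]_t (1 + c / m.+1%:R)%:E = (1 + c / m.+1%:R)%:E)%E.
  by rewrite integral_cst// -[RHS]mule1; congr mule; exact: probability_setT.
rewrite ge0_integralZl_EFin//; last first.
- exact/measurable_EFinP.
by rewrite integral_normr_ae01// EX -EFinM -EFinD lee_fin addrAC.
Qed.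

(** The staircase with [m + 1] steps has mean at most
    [1 + c p + c / (m + 1)], so the product rule for step functions bounds the
    integral by the [k]-th power of that number, for every [m]. *)
Lemma kwise_prod_affine_le (n k : nat) (X : 'I_n -> {RV P >-> R})
    (A : {set 'I_n}) (c p : R) :
  kwise_independent k X -> #|A| = k -> 0 <= c ->
  (forall i, {ae P, forall t, 0 <= X i t <= 1}) ->
  (forall i, ('E_P[X i] = p%:E)%E) ->
  (\int[P]_t (\prod_(i in A) (1 + c * `|X i t|))%:E
     <= ((1 + c * p) ^+ k)%:E)%E.
Proof.
move=> indep cardA c0 X01 EX.
have bound m : (\int[P]_t (\prod_(i in A) (1 + c * `|X i t|))%:E
     <= ((1 + c * p + c * m.+1%:R^-1) ^+ k)%:E)%E.
  apply: (@le_trans _ _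
      (\int[P]_t (\prod_(i in A) stair c m (X i t))%:E)%E).
    apply: ae_ge0_le_integral => //.
    - by move=> t _; rewrite lee_fin prodr_ge0// => i _; rewrite addr_ge0// mulr_ge0.
    - apply/measurable_EFinP.
      under eq_fun do rewrite big_mkcond.
      apply: measurable_prod => i _; case: (i \in A) => //.
      apply: measurable_funD => //; apply: measurable_funM => //.
      exact: measurableT_comp.
    - by move=> t _; rewrite lee_fin prodr_ge0// => i _; rewrite stair_ge0.
    - apply/measurable_EFinP.
      under eq_fun do rewrite big_mkcond.
      apply: measurable_prod => i _; case: (i \in A) => //.
      exact: measurable_stair.
    - have /filter_forall : forall i, {ae P, forall t, 0 <= X i t <= 1} by [].
      apply: filterS => t X01t _; rewrite lee_fin; apply: ler_prod => i _.
      have /andP[X0 _] := X01t i.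
      have /andP[le _] := @stair_bounds R c m _ c0 (X01t i).
      by rewrite ger0_norm// le andbT addr_ge0// mulr_ge0.
  rewrite (integral_prod_step _ _ _ _ _ _ _ indep cardA) lee_fin -cardA -prodr_const.
  apply: ler_prod => i _.
  have le := @integral_stair_le (X i) c p m c0 (X01 i) (EX i).
  have ge : (0 <= \int[P]_t (stair c m (X i t))%:E)%E.
    by apply: integral_ge0 => t _; rewrite lee_fin stair_ge0.
  rewrite fine_ge0//= -lee_fin fineK// ge0_fin_numE//.
  exact: le_lt_trans le (ltry _).
have ge : (0 <= \int[P]_t (\prod_(i in A) (1 + c * `|X i t|))%:E)%E.
  by apply: integral_ge0 => t _; rewrite lee_fin prodr_ge0// => i _;
    rewrite addr_ge0// mulr_ge0.
move: ge bound; case: (integral _ _ _) => [r|//|//] _ bound; last first.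
  by have := bound 0%N.
have lim : (fun m => 1 + c * p + c * @harmonic R m) @ \oo --> 1 + c * p + c * 0.
  apply: cvgD; first exact: cvg_cst.
  exact: (cvgM (cvg_cst c) cvg_harmonic).
rewrite mulr0 addr0 in lim.
rewrite lee_fin; apply: (@cvgr_to_ge nat \oo _ R
  (fun m => (1 + c * p + c * @harmonic R m) ^+ k)).
  exact: (cvg_comp _ (fun x => x ^+ k) lim (@exprn_continuous R k _)).
by apply: nearW => m; rewrite -lee_fin; exact: bound.
Qed.

(** Markov's inequality for [exp (h sum_i X_i)], where the [n - k] variables
    outside a set of [k] indices contribute at most [exp (h (n - k))]. *)
Lemma kwise_chernoff (n k : nat) (X : 'I_n -> {RV P >-> R}) (h p s : R) :
  (k <= n)%N -> kwise_independent k X -> 0 <= h ->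
  (forall i, {ae P, forall t, 0 <= X i t <= 1}) ->
  (forall i, ('E_P[X i] = p%:E)%E) ->
  (P [set t | (s <= \sum_(i < n) X i t)%R]
   <= (expR (h * (n - k)%:R - h * s) * (1 + (expR h - 1) * p) ^+ k)%:E)%E.
Proof.
move=> kn indep h0 X01 EX.
pose A := widen_ord kn @: [set: 'I_k]%SET.
have cardA : #|A| = k.
  rewrite card_imset ?cardsT ?card_ord// => i j /(congr1 val) ij.
  exact: val_inj.
have c0 : 0 <= expR h - 1 by rewrite subr_ge0 -expR0 ler_expR.
have mS : measurable_fun setT (fun t => \sum_(i < n) X i t).
  by apply: measurable_sum.
have mE : measurable [set t | s <= \sum_(i < n) X i t].
  rewrite (_ : [set t | _] =
      setT `&` (fun t => \sum_(i < n) X i t) @^-1` `[s, +oo[).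
    exact: mS.
  by apply/seteqP; split => t /=; rewrite in_itv/= andbT; [split|case].
have mprod : measurable_fun setT
    (fun t => \prod_(i in A) (1 + (expR h - 1) * `|X i t|)).
  under eq_fun do rewrite big_mkcond.
  apply: measurable_prod => i _; case: (i \in A) => //.
  apply: measurable_funD => //; apply: measurable_funM => //.
  exact: measurableT_comp.
have prod0 t : 0 <= \prod_(i in A) (1 + (expR h - 1) * `|X i t|).
  by apply: prodr_ge0 => i _; rewrite addr_ge0// mulr_ge0.
rewrite -[X in (P X)](setIT) -(integral_indic P)//.
apply: (@le_trans _ _ (\int[P]_t ((expR (h * (n - k)%:R - h * s))%:E *
    (\prod_(i in A) (1 + (expR h - 1) * `|X i t|))%:E))%E); last first.
  rewrite ge0_integralZl_EFin ?expR_ge0//; last 2 first.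
  - by move=> t _; rewrite lee_fin.
  - exact/measurable_EFinP.
  by rewrite EFinM lee_pmul2l ?lte_fin ?expR_gt0//; exact: kwise_prod_affine_le.
apply: ae_ge0_le_integral => //.
- exact/measurable_EFinP.
- by move=> t _; rewrite -EFinM lee_fin mulr_ge0 ?expR_ge0.
- by apply: emeasurable_funM => //; exact/measurable_EFinP.
have /filter_forall : forall i, {ae P, forall t, 0 <= X i t <= 1} by [].
apply: filterS => t X01t _; rewrite -EFinM lee_fin indicE.
have [st|st] := pselect (s <= \sum_(i < n) X i t); last first.
  by rewrite memNset// mulr_ge0 ?expR_ge0.
rewrite mem_set//=.
have le_prod : expR (h * \sum_(i in A) X i t) <=
    \prod_(i in A) (1 + (expR h - 1) * `|X i t|).
  rewrite mulr_sumr expR_sum; apply: ler_prod => i _; rewrite expR_ge0/=.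
  by have /andP[X0 _] := X01t i; rewrite ger0_norm// expR_chord.
apply: (@le_trans _ _ (expR (h * (n - k)%:R - h * s)
    * expR (h * \sum_(i in A) X i t))); last first.
  by rewrite ler_wpM2l ?expR_ge0.
have leC : \sum_(i in ~: A) X i t <= (n - k)%:R.
  have -> : (n - k)%:R = \sum_(i in ~: A) 1 :> R.
    by rewrite sumr_const cardsCs finset.setCK card_ord cardA.
  by apply: ler_sum => i _; have /andP[] := X01t i.
rewrite -expRD -[leLHS]expR0 ler_expR -mulrBr -mulrDr mulr_ge0//.
rewrite addrAC subr_ge0 (le_trans st)//.
rewrite (bigID (mem A))/= addrC lerD2r//.
by rewrite (eq_bigl (fun i => i \in ~: A))// => i; rewrite /= inE.
Qed.

End kwise.

(** * Optimizing the exponent *)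

(** The logarithm in the first term is the exponent [h] that minimizes
    [ln (1 + (exp h - 1) p) - h t], and the minimum is [- kl_dist t p]. *)
Lemma kl_dist_tilt (R : realType) (t p : R) :
  0 < p < 1 -> 0 < t < 1 ->
  kl_dist t p =
    t * ln (t / p * ((1 - p) / (1 - t))) - ln ((1 - p) / (1 - t)).
Proof.
move=> /andP[p0 p1] /andP[t0 t1].
have q0 : 0 < (1 - p) / (1 - t) by rewrite divr_gt0 ?subr_gt0.
have tp0 : 0 < t / p by rewrite divr_gt0.
rewrite /kl_dist (@lnM _ (t / p)) ?posrE// -(invf_div (1 - p) (1 - t)) lnV ?posrE//.
by ring.
Qed.

Theorem theorem1p12 (d : measure_display) (T : measurableType d)
    (R : realType) (P : probability T R) (n k : nat) (p eps : R)
    (X : 'I_n -> {RV P >-> R}) :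
  (1 <= k)%N -> (k <= n)%N ->
  0 < p -> p < 1 ->
  kwise_independent k X ->
  (forall i, {ae P, forall t, 0 <= X i t <= 1}) ->
  (forall i, ('E_P[X i] = p%:E)%E) ->
  0 < eps -> p * (1 + eps) < 1 ->
  (P [set t | (n%:R * p * (1 + eps) <= \sum_(i < n) X i t)%R]
   <= (1 / (p - p ^+ 2) ^+ (n - k)
       * expR (- (n%:R * kl_dist (p * (1 + eps)) p)))%:E)%E.
Proof.
move=> _ kn p0 p1 indep X01 EX eps0.
rewrite -mulrA; set t := p * (1 + eps) => t1.
have pt : p < t by rewrite /t ltr_pMr// ltrDl.
have t0 : 0 < t := lt_trans p0 pt.
pose b := (1 - p) / (1 - t); pose u := t / p * b.
have b0 : 0 < b by rewrite divr_gt0 ?subr_gt0.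
have u1 : 1 < u.
  rewrite /u /b mulf_div ltr_pdivlMr ?mulr_gt0 ?subr_gt0// mul1r.
  by rewrite !mulrBr !mulr1 [t * p]mulrC ltrD2r.
have u0 : 0 < u := lt_trans ltr01 u1.
have h0 : 0 <= ln u by rewrite ln_ge0// ltW.
apply: (le_trans (@kwise_chernoff _ _ _ P _ _ X (ln u) p (n%:R * t)
  kn indep h0 X01 EX)).
rewrite lee_fin lnK ?posrE//.
have -> : 1 + (u - 1) * p = b.
  by rewrite /u /b; field; rewrite subr_eq0 !gt_eqF.
have expu j : expR (ln u * j%:R) = u ^+ j.
  by rewrite mulrC expRM_natl ?lnK ?posrE.
have expb j : expR (ln b * j%:R) = b ^+ j.
  by rewrite mulrC expRM_natl ?lnK ?posrE.
(* Apart from the common factor [exp (- n t ln u)], the bound at hand has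
   [u ^ (n - k) b ^ k] where [exp (- n D)] has [b ^ n]; the quotient of the two
   is [(u / b) ^ (n - k) = (t / p) ^ (n - k)]. *)
have -> : expR (- (n%:R * kl_dist t p))
    = expR (- (ln u * (n%:R * t))) * b ^+ n.
  rewrite kl_dist_tilt ?p0 ?t0// -/b -/u -expb -expRD; congr expR; ring.
have -> : expR (ln u * (n - k)%:R - ln u * (n%:R * t)) * b ^+ k
    = (t / p) ^+ (n - k) * (expR (- (ln u * (n%:R * t))) * b ^+ n).
  rewrite expRD expu {1}/u exprMn (_ : b ^+ n = b ^+ (n - k) * b ^+ k).
    by ring.
  by rewrite -exprD subnK.
rewrite ler_wpM2r ?mulr_ge0 ?expR_ge0 ?exprn_ge0 ?(ltW b0)//.
have pp0 : 0 < p - p ^+ 2 by rewrite subr_gt0 expr2 gtr_pMr.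
rewrite -[1](expr1n _ (n - k)) -expr_div_n.
rewrite lerXn2r ?nnegrE ?divr_ge0 ?(ltW p0) ?(ltW t0) ?(ltW pp0)//.
rewrite ler_pdivrMr// mulrAC ler_pdivlMr// mul1r.
apply: (@le_trans _ _ (1 * (p - p ^+ 2))); last by rewrite mul1r gerBl sqr_ge0.
by rewrite ler_wpM2r ?(ltW pp0)// ltW.
Qed.
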